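(* Let $n,r$ be positive integers. The determinants of the matrices $H_D,H_S,H_I,H_{II}$ are given by $$\det H_D=\det F_D,\qquad \det H_S=2^{(r-1)(n-1)}\det F_S,\qquad \det H_{I}=\det F_{I},\qquad \det H_{II}=(-1)^{r(n-1)}\det F_{II}.$$
   Context: $N_r$ is the $r\times r$ matrix with all entries on and above the diagonal equal to $-1$ and zeros below; $M_r=-N_r^t$; $X_r=N_r^{-1}M_r$; $S_r=\sum_{i=1}^{r-1}E_{i,i+1}-E_{r,1}$ with $E_{ij}$ the $r\times r$ matrix units. For $r\times r$ integer matrices $A,M$ with $A^t=-A$, put $N=-M^t$ and let $H(A,M)$ be the $nr\times nr$ matrix of $n\times n$ blocks of size $r\times r$ with diagonal blocks $A$, blocks $M$ above and $N$ below the diagonal. Then: - Dipper–Donkin: $H_D=H(0,M_r)$, $F_D=N_rX_r(\mathbb I-X_r^{n-1})(\mathbb I-X_r)^{-1}$; - FRT: $H_S=H(-(M_r+N_r),\mathbb I)$, $F_S=(\mathbb I+S_r^n)(\mathbb I-S_r)^{-1}$; - Combined I: $H_I=H(M_r+N_r,M_r)$, $F_I=M_r(\mathbb I-X_r^{-(n+1)})(\mathbb I-X_r^{-1})^{-1}$; - Combined II: $H_{II}=H(M_r+N_r,N_r)$, $F_{II}=N_r(\mathbb I-X_r^{n+1})(\mathbb I-X_r)^{-1}$. *)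

(* Defs.v *)
From mathcomp Require Import all_boot all_order all_algebra.

Set Implicit Arguments.
Unset Strict Implicit.
Unset Printing Implicit Defensive.

Import Order.TTheory GRing.Theory Num.Theory.
Local Open Scope ring_scope.

Definition Nr (R : pzRingType) (r : nat) : 'M[R]_r :=
  \matrix_(i < r, j < r) (if (i <= j)%N then -1 else 0).

Definition Mr (R : pzRingType) (r : nat) : 'M[R]_r := - (Nr R r)^T.

(* E_{i,i+1} for all i, minus E_{r,1}; indices here start at 0. For r = 1 the
   only entry is -1. *)
Definition Sr (R : pzRingType) (r : nat) : 'M[R]_r :=
  \matrix_(i < r, j < r)
    ((j == i.+1 :> nat)%:R - ((i.+1 == r) && (j == 0 :> nat))%:R).

(* H(A,M) has size \sum_(i < n) r, which is n * r by sum_nat_const and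
   card_ord. *)
Definition Hmx (n r : nat) (A M : 'M[int]_r) : 'M[int]_(\sum_(i < n) r) :=
  \mxblock_(i < n, j < n)
    (if i == j then A else if (i < j)%N then M else - M^T).

Definition HD (n r : nat) := Hmx n 0 (Mr int r).
Definition HS (n r : nat) := Hmx n (- (Mr int r + Nr int r)) 1.
Definition HI (n r : nat) := Hmx n (Mr int r + Nr int r) (Mr int r).
Definition HII (n r : nat) := Hmx n (Mr int r + Nr int r) (Nr int r).

(* The F matrices live over rat because I - X_r and I - S_r are invertible over
   the rationals but not over the integers: their determinants are r + 1 (up to
   sign) and 2. Hence every invmx below is applied to an invertible matrix, and
   its default value on singular matrices is never used. *)
Definition Xr (r : nat) : 'M[rat]_r := invmx (Nr rat r) *m Mr rat r.

Definition FD (n r : nat) : 'M[rat]_r :=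
  Nr rat r *m Xr r *m (1 - Xr r ^+ n.-1) *m invmx (1 - Xr r).

Definition FS (n r : nat) : 'M[rat]_r :=
  (1 + Sr rat r ^+ n) *m invmx (1 - Sr rat r).

Definition FI (n r : nat) : 'M[rat]_r :=
  Mr rat r *m (1 - invmx (Xr r) ^+ n.+1) *m invmx (1 - invmx (Xr r)).

Definition FII (n r : nat) : 'M[rat]_r :=
  Nr rat r *m (1 - Xr r ^+ n.+1) *m invmx (1 - Xr r).

(* Main.v *)
(* Subtracting consecutive block rows of the block Toeplitz matrix with diagonal
   A, blocks M above and N below leaves, except in the last row, only the blocks
   P = A - N on the diagonal and Q = M - A just above it. If P Y = - Q,
   multiplying on the right by the unitriangular matrix of blocks Y^(j - i)
   kills Q, so the determinant is
   det(P)^(n-1) det(A + N (Y + ... + Y^(n-1))). In the four cases Y is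
   X, S, X^-1 and X, and the second factor is a geometric sum; in the FRT case
   this rests on the Cayley-type identity
   - (M_r + N_r) = (1 + S)(1 - S)^-1. *)
Require Import Defs.
From mathcomp Require Import all_boot all_order all_algebra.

Set Implicit Arguments.
Unset Strict Implicit.
Unset Printing Implicit Defensive.

Import Order.TTheory GRing.Theory Num.Theory.
Local Open Scope ring_scope.

(** * Determinants of block triangular matrices *)

Lemma det_castmx (R : comPzRingType) (m n : nat) (e : m = n) (A : 'M[R]_m) :
  \det (castmx (e, e) A) = \det A.
Proof. by case: n / e; rewrite castmx_id. Qed.

Lemma det_mxblock_trig (R : comPzRingType) (n : nat) (p_ : 'I_n -> nat)
    (B : forall i j, 'M[R]_(p_ i, p_ j)) :
  (forall i j : 'I_n, (i < j)%N -> B i j = 0) ->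
  \det (\mxblock_(i, j) B i j) = \prod_i \det (B i i).
Proof.
elim: n p_ B => [|n IHn] p_ B B0.
  rewrite [RHS]big_ord0; move: (\mxblock_(i, j) _); rewrite big_ord0 => C.
  exact: det_mx00.
rewrite mxblock_recul det_castmx.
have -> : \mxrow_j B ord0 (lift ord0 j) = 0.
  rewrite -[RHS](mxrow0 (q_ := fun j => p_ (lift ord0 j))).
  by apply: eq_mxrow => j; rewrite B0.
rewrite det_lblock big_ord_recl; congr (_ * _).
by apply: IHn => i j lt_ij; rewrite B0 // !lift0 ltnS.
Qed.

Lemma det_mxblock_trig_tr (R : comPzRingType) (n : nat) (p_ : 'I_n -> nat)
    (B : forall i j, 'M[R]_(p_ i, p_ j)) :
  (forall i j : 'I_n, (j < i)%N -> B i j = 0) ->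
  \det (\mxblock_(i, j) B i j) = \prod_i \det (B i i).
Proof.
move=> B0; rewrite -det_tr tr_mxblock det_mxblock_trig.
  by apply: eq_bigr => i _; rewrite det_tr.
by move=> i j lt_ij; rewrite B0 ?trmx0.
Qed.

(** * Determinants of block Toeplitz matrices *)

Definition block_toeplitz (R : Type) (n r : nat) (A M N : 'M[R]_r) :
    'M[R]_(\sum_(i < n) r) :=
  \mxblock_(i < n, j < n) (if i == j then A else if (i < j)%N then M else N).

Lemma map_block_toeplitz (R S : Type) (f : R -> S) (n r : nat)
    (A M N : 'M[R]_r) :
  map_mx f (block_toeplitz n A M N) =
  block_toeplitz n (map_mx f A) (map_mx f M) (map_mx f N).
Proof.
by apply/matrixP => i j; rewrite !mxE; do 2?[case: ifP => _]; rewrite mxE.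
Qed.

(** Consecutive block rows agree outside the columns [i] and [i'], where they differ by [A - N] and
    by [M - A]; the latter is [- (A - N) *m Y] by hypothesis, so [A - N] factors out. *)
Lemma block_toeplitz_rowB (R : comPzRingType) (n r : nat) (A M N Y : 'M[R]_r)
    (i i' k : 'I_n) : (A - N) *m Y = A - M -> i' = i.+1 :> nat ->
  (if i == k then A else if (i < k)%N then M else N) -
  (if i' == k then A else if (i' < k)%N then M else N) =
  (A - N) *m ((i == k)%:R *: 1%:M - (i' == k)%:R *: Y).
Proof.
move=> PY i'E; rewrite mulmxBr -!scalemxAr mulmx1 PY -!val_eqE /= i'E.
case: (ltngtP i k) => [lt_ik|lt_ki|eq_ik].
- case: (ltngtP i.+1 k) => [_|lt_ki|_].
  + by rewrite !scale0r !subrr.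
  + by move: lt_ki; rewrite ltnNge lt_ik.
  + by rewrite scale0r scale1r sub0r opprB.
- have lt_ki1 := ltnW lt_ki : (k < i.+1)%N.
  rewrite (gtn_eqF lt_ki1) ltnNge (ltnW lt_ki1).
  by rewrite !scale0r !subrr.
- by rewrite -eq_ik gtn_eqF // ltnNge leqnSn /= scale1r scale0r subr0.
Qed.

Lemma det_block_toeplitz (R : comPzRingType) (n r : nat) (A M N Y : 'M[R]_r) :
  (A - N) *m Y = A - M ->
  \det (block_toeplitz n.+1 A M N) =
  \det (A - N) ^+ n * \det (A + N *m \sum_(k < n) Y ^+ k.+1).
Proof.
move=> PY.
pose h (i j : 'I_n.+1) := if i == j then A else if (i < j)%N then M else N.
(* The test [i <= j] guards the truncated subtraction: below the diagonal [Y ^+ (j - i)] would be 1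
   instead of 0. *)
pose v (i j : 'I_n.+1) : 'M[R]_r := if (i <= j)%N then Y ^+ (j - i) else 0.
pose u (i j : 'I_n.+1) : 'M[R]_r :=
  (i == j)%:R *: 1%:M - (j == i.+1 :> nat)%:R *: 1%:M.
pose U := \mxblock_(i < n.+1, j < n.+1) u i j.
pose V := \mxblock_(i < n.+1, j < n.+1) v i j.
have detV : \det V = 1.
  rewrite det_mxblock_trig_tr => [|i j lt_ji]; last by rewrite /v leqNgt lt_ji.
  by rewrite big1 // => i _; rewrite /v leqnn subnn expr0 det1.
have detU : \det U = 1.
  rewrite det_mxblock_trig_tr => [|i j lt_ji].
    rewrite big1 // => i _.
    by rewrite /u eqxx ltn_eqF // scale0r subr0 scale1r det1.
  by rewrite /u -val_eqE gtn_eqF // ltn_eqF ?scale0r ?subr0 // ltnW.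
pose g i j := \sum_k h i k *m v k j.
(* [insub] fails exactly in the last block row, from which nothing is subtracted. *)
have uE i (f : 'I_n.+1 -> 'M[R]_r) :
    \sum_j u i j *m f j =
    f i - (if insub i.+1 is Some i' then f i' else 0).
  rewrite /u; under eq_bigr do rewrite mulmxBl -!scalemxAl !mul1mx.
  rewrite sumrB; congr (_ - _).
    rewrite (bigD1 i) //= eqxx scale1r big1 ?addr0 // => j.
    by rewrite eq_sym => /negPf->; rewrite scale0r.
  case: insubP => [i' _ i'E|lt_in].
    rewrite (bigD1 i') //= i'E eqxx scale1r big1 ?addr0 // => j.
    by rewrite -val_eqE i'E => /negPf->; rewrite scale0r.
  rewrite big1 // => j _; rewrite ltn_eqF ?scale0r //.
  by rewrite (leq_trans (ltn_ord j)) // leqNgt.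
(* Above the last row, block [(i, j)] is [A - N] times [v i j - Y *m v i' j]. For [i < j] the two
   powers of [Y] cancel, and for [i = j] only 1 remains. *)
have ugE (i j : 'I_n.+1) : (i < n)%N ->
    \sum_k u i k *m g k j = (i == j)%:R *: (A - N).
  move=> lt_in; rewrite uE.
  case: insubP => [i' _ i'E|]; last by rewrite ltnS lt_in.
  rewrite /g -sumrB; under eq_bigr do
    rewrite -mulmxBl (block_toeplitz_rowB _ PY i'E) mulmxBr mulmxBl.
  rewrite sumrB (bigD1 i) //= eqxx scale1r mulmx1 big1 ?addr0; last first.
    by move=> k; rewrite eq_sym => /negPf->; rewrite scale0r mulmx0 mul0mx.
  rewrite (bigD1 i') //= eqxx scale1r [X in _ - (_ + X)]big1 ?addr0; last first.
    by move=> k; rewrite eq_sym => /negPf->; rewrite scale0r mulmx0 mul0mx.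
  rewrite -mulmxA -mulmxBr /v i'E -val_eqE.
  case: (ltngtP i j) => [lt_ij|lt_ji|eq_ij].
  - by rewrite !mulmxE -exprS subnSK // subrr mulr0 scale0r.
  - by rewrite mulmx0 subr0 mulmx0 scale0r.
  - by rewrite mulmx0 subr0 eq_ij subnn mulmx1 scale1r.
have -> : \det (block_toeplitz n.+1 A M N) =
          \det (U *m (block_toeplitz n.+1 A M N *m V)).
  by rewrite !det_mulmx detU detV mul1r mulr1.
rewrite mul_mxblock mul_mxblock det_mxblock_trig => [|i j lt_ij]; last first.
  rewrite ugE; first by rewrite -val_eqE ltn_eqF // scale0r.
  by rewrite (leq_trans lt_ij) // -ltnS.
rewrite big_ord_recr /=; congr (_ * _).
  rewrite -[n in RHS]card_ord -prodr_const; apply: eq_bigr => i _.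
  by rewrite ugE ?eqxx ?scale1r //=.
rewrite uE insubF ?ltnn // subr0 /g big_ord_recr /= /h /v eqxx subnn leqnn.
rewrite expr0 mulmx1 addrC; congr (\det (A + _)).
(* The last diagonal block is [A] plus the sum of [N Y^(n-k)] over [k < n]; reversing the order
   turns the exponents into [k.+1]. *)
rewrite mulmx_sumr (reindex_inj rev_ord_inj); apply: eq_bigr => k _ /=.
have lt_kn : (n - k.+1 < n)%N by rewrite ltn_subrL (leq_trans _ (ltn_ord k)).
rewrite -val_eqE /= gtn_eqF // ltnNge (ltnW lt_kn) /=.
by rewrite subKn.
Qed.

(** Moves the determinant from [int] to [rat], where a [Y] built from inverse matrices can live. *)
Lemma det_Hmx (n r : nat) (A M : 'M[int]_r) (A' M' N' Y : 'M[rat]_r) :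
  map_mx intr A = A' -> map_mx intr M = M' -> - M'^T = N' ->
  (A' - N') *m Y = A' - M' ->
  (\det (Hmx n.+1 A M))%:~R =
  \det (A' - N') ^+ n * \det (A' + N' *m \sum_(k < n) Y ^+ k.+1).
Proof.
move=> AE ME NE; rewrite -det_map_mx => /det_block_toeplitz <-.
congr (\det _); rewrite [LHS]map_block_toeplitz AE ME.
by rewrite map_mxN -map_trmx ME NE.
Qed.

Lemma mul_1B_sum_expr (R : pzRingType) (x : R) (n : nat) :
  (\sum_(k < n) x ^+ k) * (1 - x) = 1 - x ^+ n.
Proof.
elim: n => [|n IHn]; first by rewrite big_ord0 mul0r subrr.
by rewrite big_ord_recr /= mulrDl IHn mulrBr mulr1 -exprSr addrA subrK.
Qed.

(** * The triangular matrices N and M, and their quotient X *)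

Section Triangular.

Variable r : nat.
Notation N := (Nr rat r).
Notation M := (Mr rat r).

Lemma map_Nr : map_mx intr (Nr int r) = N.
Proof. by apply/matrixP => i j; rewrite !mxE; case: ifP; rewrite ?rmorphN. Qed.

Lemma map_Mr : map_mx intr (Mr int r) = M.
Proof. by rewrite /Mr map_mxN -map_trmx map_Nr. Qed.

Lemma trmx_Mr : - M^T = N.
Proof. by rewrite /Mr linearN /= trmxK opprK. Qed.

Lemma det_opp (A : 'M[rat]_r) : \det (- A) = (-1) ^+ r * \det A.
Proof. by rewrite -scaleN1r detZ. Qed.

Lemma det_Nr : \det N = (-1) ^+ r.
Proof.
rewrite -det_tr det_trig; last first.
  by apply/is_trig_mxP => i j lt_ij; rewrite !mxE leqNgt lt_ij.
rewrite -[in RHS](card_ord r) -prodr_const.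
by apply: eq_bigr => i _; rewrite !mxE leqnn.
Qed.

Lemma det_NrN : \det (- N) = 1.
Proof. by rewrite det_opp det_Nr -expr2 sqrr_sign. Qed.

Lemma det_Mr : \det M = 1.
Proof. by rewrite /Mr -linearN /= det_tr det_NrN. Qed.

Lemma unit_Nr : N \in unitmx.
Proof. by rewrite unitmxE det_Nr unitrX // unitrN1. Qed.

Lemma unit_Mr : M \in unitmx.
Proof. by rewrite unitmxE det_Mr unitr1. Qed.

Lemma unit_Xr : Xr r \in unitmx.
Proof. by rewrite unitmx_mul unitmx_inv unit_Nr unit_Mr. Qed.

Lemma mul_Nr_Xr : N *m Xr r = M.
Proof. by rewrite mulKVmx // unit_Nr. Qed.

Lemma mul_Mr_invXr : M *m invmx (Xr r) = N.
Proof. by rewrite -mul_Nr_Xr mulmxK // unit_Xr. Qed.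

(** Since N - M = N + N^t = -(1 + J) with J the all-ones matrix and J^2 = r J, an explicit inverse
    is J/(r+1) - 1. Factoring N - M as N(1 - X) or M(X^-1 - 1) then makes both denominators
    invertible. *)
Lemma unit_NrB : N - M \in unitmx.
Proof.
pose J : 'M[rat]_r := const_mx 1.
have NBE : N - M = - (1%:M + J).
  apply/matrixP => i j; rewrite !mxE -val_eqE.
  by case: (ltngtP i j) => _.
have JJ : J *m J = r%:R *: J.
  apply/matrixP => i j; rewrite !mxE; under eq_bigr do rewrite !mxE mulr1.
  by rewrite sumr_const card_ord mulr1.
have r1 : r.+1%:R != 0 :> rat by rewrite pnatr_eq0.
suff /mulmx1_unit[] : (N - M) *m (r.+1%:R^-1 *: J - 1%:M) = 1%:M by [].
rewrite NBE mulNmx -mulmxN opprB mulmxBr mulmx1 mulmxDl mul1mx.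
rewrite -scalemxAr JJ -scalerDr.
have -> : J + r%:R *: J = r.+1%:R *: J by rewrite -nat1r scalerDl scale1r.
by rewrite scalerA mulVf // scale1r addrK.
Qed.

Lemma unit_1BXr : 1 - Xr r \in unitmx.
Proof.
have := unit_NrB.
by rewrite -mul_Nr_Xr -{1}[N]mulmx1 -mulmxBr unitmx_mul => /andP[].
Qed.

Lemma unit_1BinvXr : 1 - invmx (Xr r) \in unitmx.
Proof.
have := unit_NrB; rewrite -mul_Mr_invXr -{2}[M]mulmx1 -mulmxBr unitmx_mul.
by case/andP => _; rewrite -opprB -scaleN1r unitmxZ // unitrN1.
Qed.

End Triangular.

(** * The signed cyclic shift S and the FRT case *)

Section Cayley.

Variable p : nat.
Notation r := p.+1.
Notation N := (Nr rat r).
Notation M := (Mr rat r).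
Notation S := (Sr rat r).

(** Right multiplication by S moves each column one place to the right; the last one wraps around
    with its sign changed. *)
Lemma mul_Sr (A : 'M[rat]_r) (i j : 'I_r) :
  (A *m S) i j = if j == 0 then - A i ord_max else A i (inord j.-1).
Proof.
rewrite mxE; under eq_bigr do rewrite !mxE mulrBr.
rewrite sumrB.
have -> : \sum_k A i k * ((k.+1 == r) && (j == 0 :> nat))%:R =
          if j == 0 then A i ord_max else 0.
  rewrite (bigD1 ord_max) //= eqxx /= big1 ?addr0 => [|k].
    by rewrite -val_eqE; case: ifP => _; rewrite ?mulr1 ?mulr0.
  by rewrite -val_eqE /= eqSS => /negPf->; rewrite mulr0.
case: eqP => [->|/eqP j0].
  by rewrite big1 ?sub0r // => k _; rewrite mulr0.
have j_gt0 : (0 < j)%N by rewrite lt0n.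
have j1E : (inord j.-1 : 'I_r) = j.-1 :> nat.
  by rewrite inordK // prednK // ltnW.
rewrite (bigD1 (inord j.-1)) //= j1E prednK // eqxx mulr1 subr0.
rewrite big1 ?addr0 // => k; rewrite -val_eqE /= j1E => /negPf kj.
by rewrite -(prednK j_gt0) eqSS eq_sym kj mulr0.
Qed.

Lemma skewE (i j : 'I_r) : (- (M + N)) i j = (i < j)%N%:R - (j < i)%N%:R.
Proof. by rewrite !mxE; case: ltngtP. Qed.

(** In the sign matrix -(M + N), columns j-1 and j differ only in rows j-1 and j, by 1 each: this is
    column j of 1 + S. Column 0 is instead added to the last column, because of the sign in the
    wraparound. *)
Lemma Cayley_Sr : - (M + N) *m (1 - S) = 1 + S.
Proof.
apply/matrixP => i j; rewrite mulmxBr mulmx1 [LHS]mxE [X in _ + X]mxE mul_Sr.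
rewrite !skewE !mxE -!val_eqE /=.
case: (posnP j) => [->|j_gt0].
  have := ltn_ord i; rewrite ltn0 eqSS andbT ltnS.
  by case: (posnP i) => [->|i_gt0]; case: ltngtP.
rewrite inordK; last by rewrite prednK // ltnW.
case: (nat_of_ord j) j_gt0 => //= k _; rewrite andbF eqSS.
case: (ltngtP i k) => [lt_ik|lt_ki|->].
- have lt_ik1 : (i < k.+1)%N by apply: leqW.
  by rewrite lt_ik1 ltn_eqF // ltnNge ltnW.
- by rewrite ltnS leqNgt lt_ki; have := lt_ki; case: (ltngtP k.+1 i).
- by rewrite ltnSn ltn_eqF // ltnNge ltnW.
Qed.

Lemma det_1BMN : \det (1 - (M + N)) = 2 ^+ p.
Proof.
(* Adding the all-ones last column to the others gives a triangular matrix. *)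
pose U : 'M[rat]_r :=
  \matrix_(k, j) ((k == j)%:R + ((k == ord_max) && (j != ord_max))%:R).
have detU : \det U = 1.
  rewrite det_trig; last first.
    apply/is_trig_mxP => i j lt_ij; rewrite !mxE -!val_eqE /=.
    rewrite (ltn_eqF lt_ij) ltn_eqF ?addr0 //.
    by rewrite (leq_trans lt_ij) // -ltnS.
  by rewrite big1 // => i _; rewrite mxE eqxx; case: eqP => _; rewrite ?andbF.
have PUE (i j : 'I_r) : ((1 - (M + N)) *m U) i j =
    (if (j < i)%N then 0 else if j == ord_max then 1 else 2).
  rewrite mxE; under eq_bigr do rewrite [U _ _]mxE mulrDr.
  rewrite big_split /= (bigD1 j) //= eqxx mulr1 big1 ?addr0; last first.
    by move=> k /negPf->; rewrite mulr0.
  rewrite (bigD1 ord_max) //= eqxx big1 ?addr0; last first.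
    by move=> k /negPf->; rewrite mulr0.
  rewrite [X in X + _]mxE [X in _ + X * _]mxE !skewE !mxE -!val_eqE /=.
  have -> : (i == p :> nat)%:R + ((i < p)%:R - (p < i)%:R) = 1 :> rat.
    by have := ltn_ord i; rewrite ltnS; case: ltngtP.
  rewrite mul1r; case: (ltngtP i j) => [_|lt_ji|_].
  - by case: eqP.
  - by rewrite ltn_eqF // (leq_trans lt_ji) // -ltnS.
  - by case: eqP.
have -> : \det (1 - (M + N)) = \det ((1 - (M + N)) *m U)^T.
  by rewrite det_tr det_mulmx detU mulr1.
rewrite det_trig; last first.
  by apply/is_trig_mxP => i j lt_ij; rewrite mxE PUE lt_ij.
(* The last column was left unchanged, so its diagonal entry is 1 and only the other [p] contribute
   a factor 2. *)
rewrite big_ord_recr /= mxE PUE ltnn eqxx mulr1.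
rewrite -[in RHS](card_ord p) -prodr_const; apply: eq_bigr => i _.
by rewrite mxE PUE ltnn -val_eqE /= ltn_eqF.
Qed.

End Cayley.

Theorem corollary3p2 (n r : nat) (hn : (0 < n)%N) (hr : (0 < r)%N) :
  [/\ (\det (HD n r))%:~R = \det (FD n r),
      (\det (HS n r))%:~R = 2 ^+ (r.-1 * n.-1)%N * \det (FS n r),
      (\det (HI n r))%:~R = \det (FI n r)
    & (\det (HII n r))%:~R = (-1) ^+ (r * n.-1)%N * \det (FII n r)].
Proof.
case: n hn => // n _; rewrite [n.+1.-1]/=.
have geom (Y : 'M[rat]_r) (k : nat) : 1 - Y \in unitmx ->
    (1 - Y ^+ k) *m invmx (1 - Y) = \sum_(i < k) Y ^+ i.
  by move=> uY; rewrite -mul_1B_sum_expr mulmxK.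
have sumS (Y : 'M[rat]_r) (k : nat) :
    \sum_(i < k) Y ^+ i.+1 = Y *m \sum_(i < k) Y ^+ i.
  by rewrite mulmx_sumr; apply: eq_bigr => i _; rewrite exprS.
have map_DNr : map_mx intr (Mr int r + Nr int r) = Mr rat r + Nr rat r.
  by rewrite map_mxD map_Nr map_Mr.
split.
- have PY : (0 - Nr rat r) *m Xr r = 0 - Mr rat r.
    by rewrite !sub0r mulNmx mul_Nr_Xr.
  rewrite (det_Hmx n (map_mx0 _ _ _) (map_Mr r) (trmx_Mr r) PY).
  rewrite sub0r det_NrN expr1n mul1r add0r sumS.
  by rewrite /FD -mulmxA geom ?unit_1BXr // mulmxA.
- case: r hr {geom} sumS map_DNr => // p _ sumS map_DNr.
  set S := Sr rat p.+1; set A := - (Mr rat p.+1 + Nr rat p.+1).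
  have AS : A - A *m S = 1 + S by rewrite -Cayley_Sr mulmxBr mulmx1.
  (* The Cayley identity gives (A + 1)(1 - S) = (1 + S) + (1 - S) = 2, which inverts 1 - S over the
     rationals. *)
  have PS : (A + 1) *m (1 - S) = 2%:M.
    by rewrite mulmxDl Cayley_Sr mul1mx addrACA addrN addr0 -raddfD.
  have uS : 1 - S \in unitmx.
    apply: (proj2 (mulmx1_unit (A := 2^-1 *: (A + 1)) _)).
    by rewrite -scalemxAl PS scale_scalar_mx mulVf.
  have PY : (A - - 1) *m S = A - 1.
    have -> : A - 1 = A - (1 + S) + S by rewrite opprD addrA subrK.
    by rewrite opprK mulmxDl mul1mx -AS subKr.
  rewrite (det_Hmx (M' := 1) (N' := -1) n _ _ _ PY).
  + rewrite opprK [A + 1]addrC det_1BMN exprM; congr (_ * \det _).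
    (* Multiplied by 1 - S, the second factor A - (S + ... + S^n) becomes 1 + S - S(1 - S^n) = 1 +
       S^(n+1). *)
    rewrite -[LHS](mulmxK uS); congr (_ *m _).
    rewrite mulmxDl Cayley_Sr mulNmx mul1mx sumS mulNmx -mulmxA.
    rewrite [X in S *m X]mul_1B_sum_expr mulmxBr mulmx1.
    rewrite -[S *m S ^+ n]/(S * S ^+ n) -exprS opprB.
    by rewrite addrA addrAC addrK.
  + by rewrite map_mxN map_DNr.
  + by rewrite map_mx1.
  + by rewrite trmx1.
- have PY : (Mr rat r + Nr rat r - Nr rat r) *m invmx (Xr r) =
            Mr rat r + Nr rat r - Mr rat r.
    by rewrite addrK mul_Mr_invXr addrC addKr.
  rewrite (det_Hmx n map_DNr (map_Mr r) (trmx_Mr r) PY) addrK det_Mr expr1n.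
  (* The geometric sum has n + 2 terms: the first two give M + M X^-1 = M + N, and M X^-1 = N turns
     the others into N X^-k for k from 1 to n. *)
  rewrite mul1r /FI -mulmxA geom ?unit_1BinvXr // 2!big_ord_recl.
  rewrite !mulmxDr mulmx1 addrA mul_Mr_invXr !mulmx_sumr.
  congr (\det (_ + _)); apply: eq_bigr => i _.
  by rewrite [RHS]mulmxA mul_Mr_invXr.
(* Here N lies above the diagonal and M below, so each diagonal factor is (M + N) - M = N, of
   determinant (-1)^r; this is the source of the sign. *)
- have NE : - (Nr rat r)^T = Mr rat r by [].
  have PY : (Mr rat r + Nr rat r - Mr rat r) *m Xr r =
            Mr rat r + Nr rat r - Nr rat r.
    by rewrite addrK [_ + Nr rat r]addrC addrK mul_Nr_Xr.
  rewrite (det_Hmx n map_DNr (map_Nr r) NE PY) [_ + Nr rat r]addrC addrK det_Nr.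
  rewrite exprM; congr (_ * _); rewrite /FII -mulmxA geom ?unit_1BXr //.
  rewrite [in RHS]big_ord_recl [in RHS]sumS mulmxDr mulmx1.
  rewrite [in RHS]mulmxA mul_Nr_Xr [in RHS]big_ord_recl.
  by rewrite mulmxDr mulmx1 addrA.
Qed.
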